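(* Let $n \ge 4$ be an integer, and define the sequence of integers $(k_j)_{j\ge 0}$ by \[ k_0 = \pi(n), \qquad k_{j+1} = \pi(n-k_j) \quad (j \ge 0). \] Then after a finite number of steps exactly one of the following cases occurs: (i) the sequence reaches a fixed point $k^{*}$, i.e., there is $J$ such that $k_j = k^{*}$ for all $j \ge J$ and $\pi(n-k^{*}) = k^{*}$; (ii) the sequence reaches a cycle $\{k',k''\}$ with $k'' = k'+1$ and $n-k'$ a prime number, where $(k_{2j})_{j\ge0}$ is a decreasing sequence which converges to $k''$, and $(k_{2j+1})_{j\ge0}$ is an increasing sequence which converges to $k'$.
   Context: $\pi(x)$ denotes the number of prime numbers less than or equal to $x$ (the prime-counting function). $p_k$ denotes the $k$th prime number, with $p_1 = 2$. Since the $k_j$ are integers, convergence means being eventually constant. *)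

(* Defs.v *)
From mathcomp Require Import all_boot.

Set Implicit Arguments.
Unset Strict Implicit.
Unset Printing Implicit Defensive.

Definition primepi (x : nat) : nat := #|[set p : 'I_x.+1 | prime p]|.

(* The subtraction of nat is truncated at 0; no truncation ever occurs along
   [kseq n], as all its terms are values of [primepi] at numbers <= n, hence
   are at most n (lemma [kseq_le] below). *)
Definition kstep (n k : nat) : nat := primepi (n - k).

Fixpoint kseq (n j : nat) : nat :=
  if j is j'.+1 then kstep n (kseq n j') else primepi n.

(* Convergence of a sequence of integers: it is eventually constant. *)
Definition converges_to (u : nat -> nat) (l : nat) : Prop :=
  exists J, forall j, J <= j -> u j = l.

(* Monotonicity is in the non-strict sense, the only one that an eventually
   constant sequence can satisfy. *)
Definition increasing_seq (u : nat -> nat) : Prop :=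
  {homo u : i j / i <= j}.

Definition decreasing_seq (u : nat -> nat) : Prop :=
  {homo u : i j / i <= j >-> j <= i}.

Definition reaches_fixed_point (n k : nat) : Prop :=
  converges_to (kseq n) k /\ primepi (n - k) = k.

Definition reaches_2cycle (n k' k'' : nat) : Prop :=
  [/\ k' <> k'', kstep n k' = k'', kstep n k'' = k'
    & exists J, kseq n J = k' \/ kseq n J = k''].

Lemma primepi_le x : primepi x <= x.
Proof.
rewrite /primepi -ltnS -[X in _ < X]card_ord -cardsT; apply/proper_card/properP.
by split; [exact: subsetT | exists ord0; rewrite !inE].
Qed.

Lemma kseq_le n j : kseq n j <= n.
Proof.
by case: j => [|j] /=; [|apply: leq_trans (leq_subr _ _)]; exact: primepi_le.
Qed.

(* Main.v *)
(* The step k |-> pi(n - k) is antitone and k_0 = pi(n) is the largest value it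
   takes, so the even terms decrease, the odd terms increase and stay below
   them, and the sequence ends up alternating between a and b <= a with
   pi(n - b) = a and pi(n - a) = b. The a - b integers of the interval
   (n - a, n - b] then contain a - b primes, so all of them are prime; as 2 and
   3 are the only consecutive primes, a - b >= 2 would force n = 3. *)
Require Import Defs.
From mathcomp Require Import all_boot zify.

Lemma primepiS x : primepi x.+1 = primepi x + prime x.+1.
Proof.
have primepiE y : primepi y = \sum_(i < y.+1) prime i.
  rewrite /primepi -sum1_card big_mkcond /=.
  by apply: eq_bigr => i _; rewrite inE; case: (prime i).
by rewrite !primepiE big_ord_recr.
Qed.

Lemma leq_primepi : {homo primepi : x y / x <= y}.
Proof.
by apply: homo_leq => [x|y x z|x]; [|exact: leq_trans|rewrite primepiS leq_addr].
Qed.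

Lemma primepi_addr_le x d : primepi (x + d) <= primepi x + d.
Proof.
elim: d => [|d IHd]; first by rewrite !addn0.
by rewrite !addnS primepiS; case: (prime _); lia.
Qed.

(** The integers of the range before [x + i] supply at most [i - 1] primes and those after it at
    most [d - i], so a total of [d] forces [x + i] to supply one. *)
Lemma primepi_addr_eq x d i :
  primepi (x + d) = primepi x + d -> 0 < i <= d -> prime (x + i).
Proof.
move=> full /andP[i_gt0 le_id]; case: i i_gt0 le_id => // i _ lt_id.
have := primepi_addr_le (x + i.+1) (d - i.+1).
have := primepi_addr_le x i.
rewrite -addnA subnKC // full addnS primepiS.
by case: (prime _) => //; lia.
Qed.

Lemma consecutive_primes p : prime p -> prime p.+1 -> p = 2.
Proof.
move=> p_pr p1_pr; have [//|p_odd] := even_prime p_pr.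
by case: (even_prime p1_pr) => [[p1]|/=]; [move: p_pr; rewrite p1|rewrite p_odd].
Qed.

Lemma leq_kstep n k l : k <= l -> kstep n l <= kstep n k.
Proof. by move=> le_kl; apply/leq_primepi/leq_sub2l. Qed.

(** Induction on [j] with [d] arbitrary: it starts from the maximality of [primepi n], and each
    application of the antitone step flips the inequality together with the parity of [j]. *)
Lemma kseq_alternate n j d :
  if odd j then kseq n j <= kseq n (j + d) else kseq n (j + d) <= kseq n j.
Proof.
elim: j => [|j IHj] /=.
  by case: d => [|d] //=; apply/leq_primepi/leq_subr.
by case: (odd j) IHj => /= /leq_kstep.
Qed.

Lemma kseq_even_decreasing n : decreasing_seq (fun j => kseq n (2 * j)).
Proof.
move=> i j le_ij; have := kseq_alternate n (2 * i) (2 * (j - i)).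
by rewrite -mulnDr subnKC // mul2n odd_double.
Qed.

Lemma kseq_odd_increasing n : increasing_seq (fun j => kseq n (2 * j + 1)).
Proof.
move=> i j le_ij; have := kseq_alternate n (2 * i + 1) (2 * (j - i)).
by rewrite addnAC -mulnDr subnKC // addn1 /= mul2n odd_double.
Qed.

Lemma kseq_even_stationary n : exists J, kseq n (2 * J.+1) = kseq n (2 * J).
Proof.
have [/existsP[J /eqP eqJ]|/existsPn noJ] :=
  boolP [exists J : 'I_n.+1, kseq n (2 * J.+1) == kseq n (2 * J)].
  by exists J.
(* Without a repetition each even term drops by at least 1, from a start of at most [n]; at
   [j = n.+1] the bound is absurd. *)
suff /(_ n.+1 (leqnn _)) : forall j, j <= n.+1 -> kseq n (2 * j) + j <= n.
  by lia.
elim=> [|j IHj] lt_jn; first by rewrite addn0 kseq_le.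
have := noJ (Ordinal lt_jn); have := @kseq_even_decreasing n _ _ (leqnSn j).
by have := IHj (ltnW lt_jn); move=> /=; lia.
Qed.

Lemma kseq_alternate_limits n :
  exists a b J, [/\ b <= a, kstep n a = b, kstep n b = a
    & forall j, J <= j -> kseq n (2 * j) = a /\ kseq n (2 * j + 1) = b].
Proof.
have [J eqJ] := kseq_even_stationary n.
exists (kseq n (2 * J)), (kseq n (2 * J + 1)), J.
have stepb : kstep n (kseq n (2 * J + 1)) = kseq n (2 * J).
  by rewrite -eqJ mulnS addn1.
have stepa : kstep n (kseq n (2 * J)) = kseq n (2 * J + 1) by rewrite addn1.
split=> //.
  by have := kseq_alternate n (2 * J) 1; rewrite mul2n odd_double.
(* Each term determines the next, so a single repetition among the even terms propagates forever. *)
suff even_a i : kseq n (2 * (J + i)) = kseq n (2 * J).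
  by move=> j /subnKC <-; rewrite [_ + 1]addn1 /= even_a stepa.
elim: i => [|i IHi]; first by rewrite addn0.
by rewrite addnS mulnS /= IHi stepa stepb.
Qed.

Lemma kstep_2cycle_consecutive n a b :
  4 <= n -> a <= n -> b < a -> kstep n a = b -> kstep n b = a ->
  a = b.+1 /\ prime (n - b).
Proof.
rewrite /kstep => n_ge4 le_an lt_ba pi_a pi_b.
(* Since [a <= n], the subtraction [n - a] is not truncated and the interval from [n - a] to [n - b]
   has length exactly [a - b]. *)
have full : primepi (n - a + (a - b)) = primepi (n - a) + (a - b).
  by rewrite pi_a (_ : n - a + (a - b) = n - b) ?pi_b; lia.
have pr i : i < a - b -> prime (n - b - i).
  move=> lt_i; rewrite (_ : n - b - i = n - a + (a - b - i)); last by lia.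
  by apply: primepi_addr_eq full _; lia.
have pr0 : prime (n - b) by rewrite -[n - b]subn0 pr //; lia.
split=> //; have [lt_b1a|] := ltnP b.+1 a; last by lia.
have nb2 : n - b - 1 = 2.
  apply: consecutive_primes; first by apply: pr; lia.
  by rewrite (_ : (n - b - 1).+1 = n - b) //; lia.
(* Now [n - b = 3], hence [a = 2]; then [b.+1 < a] leaves only [b = 0] and [n = 3]. *)
have pi3 : primepi 3 = 2.
  by rewrite !primepiS /primepi -sum1_card big_mkcond big_ord_recl big_ord0 inE.
by move: pi_b; rewrite (_ : n - b = 3) ?pi3; lia.
Qed.

Theorem theorem1 (n : nat) (hn : 4 <= n) :
  let case_i :=
    exists kstar : nat, reaches_fixed_point n kstar in
  let case_ii :=
    exists k' k'' : nat,
      [/\ reaches_2cycle n k' k'',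
          k'' = k'.+1,
          prime (n - k'),
          decreasing_seq (fun j => kseq n (2 * j)) /\
            converges_to (fun j => kseq n (2 * j)) k''
        & increasing_seq (fun j => kseq n (2 * j + 1)) /\
            converges_to (fun j => kseq n (2 * j + 1)) k'] in
  (case_i \/ case_ii) /\ ~ (case_i /\ case_ii).
Proof.
move=> case_i case_ii.
have [a [b [J [le_ba step_a step_b lim]]]] := kseq_alternate_limits n.
split.
  have [eq_ab|ne_ab] := eqVneq a b.
    left; exists a; split; last by rewrite -[RHS]step_b eq_ab.
    (* [J] counts pairs of terms: [2 * J <= j] gives [J <= j./2], which covers both parities of
       [j]. *)
    exists (2 * J) => j le_Jj.
    have [] := lim j./2; first by lia.
    rewrite -eq_ab addn1 mul2n => even_a odd_a.
    by rewrite -[j]odd_double_half; case: (odd j).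
  right; exists b, a.
  have lt_ba : b < a by rewrite ltn_neqAle eq_sym ne_ab.
  have le_an : a <= n by case: (lim J) => // <- _; apply: kseq_le.
  have [eq_a pr_nb] := kstep_2cycle_consecutive _ _ _ hn le_an lt_ba step_a step_b.
  split=> //.
  - split=> //; first by apply/eqP; rewrite eq_sym.
    by exists (2 * J); right; case: (lim J).
  - split; first exact: kseq_even_decreasing.
    by exists J => j /lim[].
  - split; first exact: kseq_odd_increasing.
    by exists J => j /lim[].
case=> [[k [[K lim_k] _]] [k' [k'' [[ne_k _ _ _] _ _ [_ [K2 lim2]] [_ [K1 lim1]]]]]].
(* Beyond all three thresholds, the terms of index [2 * j] and [2 * j + 1] both equal [k], which
   forces [k' = k'']. *)
pose j := K + K1 + K2.
by apply: ne_k; rewrite -(lim1 j) -?(lim2 j) ?lim_k //; lia.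
Qed.
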